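(* Assume (A1)--(A3), and let $(\mathbf{x}^*,\boldsymbol{\lambda}^* )$ be a saddle point of the Lagrangian $L$. For $k\ge1$ let $\tilde{\mathbf{x}}^k=\frac1k\sum_{p=0}^{k-1}\hat{\mathbf{x}}^p$ be the ergodic average of the primal sequence generated by ADAL with parameters $\rho>0$ and $\tau\in(0,1/q)$. Then for all $k\ge1$: (a) $$|F(\tilde{\mathbf{x}}^k)-F(\mathbf{x}^* )|\le\frac{1}{2k\tau}\max\{\phi^0(\mathbf{0}),\phi^0(2\boldsymbol{\lambda}^* )\},$$ where $\phi^0(\boldsymbol{\lambda})=\sum_{i=1}^N\rho\|\mathbf{A}_i(\mathbf{x}_i^0-\mathbf{x}_i^* )\|^2+\frac1\rho\|\bar{\boldsymbol{\lambda}}^0-\boldsymbol{\lambda}\|^2$; (b) $$\|\mathbf{r}(\tilde{\mathbf{x}}^k)\|\le\frac{1}{2k\tau}\Big[\sum_{i=1}^N\rho\|\mathbf{A}_i(\mathbf{x}_i^0-\mathbf{x}_i^* )\|^2+\frac2\rho\big(\|\bar{\boldsymbol{\lambda}}^0-\boldsymbol{\lambda}^*\|^2+1\big)\Big].$$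
   Context: Problem: minimize $F(\mathbf{x})=\sum_{i=1}^N f_i(\mathbf{x}_i)$ subject to $\sum_{i=1}^N\mathbf{A}_i\mathbf{x}_i=\mathbf{b}$ and $\mathbf{x}_i\in\mathcal{X}_i$, $i=1,\dots,N$. Here $f_i:\mathbb{R}^{n_i}\to\mathbb{R}$, $\mathcal{X}_i\subseteq\mathbb{R}^{n_i}$, $\mathbf{A}_i\in\mathbb{R}^{m\times n_i}$, $\mathbf{b}\in\mathbb{R}^m$, $n=\sum_i n_i$, $\mathbf{x}=[\mathbf{x}_1^\top,\dots,\mathbf{x}_N^\top]^\top\in\mathbb{R}^n$, $\mathbf{A}=[\mathbf{A}_1\dots\mathbf{A}_N]$, $\mathcal{X}=\mathcal{X}_1\times\dots\times\mathcal{X}_N$. The Lagrangian is $L(\mathbf{x},\boldsymbol{\lambda})=F(\mathbf{x})+\langle\boldsymbol{\lambda},\mathbf{A}\mathbf{x}-\mathbf{b}\rangle$. The residual is $\mathbf{r}(\mathbf{x})=\mathbf{A}\mathbf{x}-\mathbf{b}$. Norms are Euclidean. Degree: for each $j=1,\dots,m$ let $q_j$ be the number of indices $i$ such that the $j$-th row of $\mathbf{A}_i$ is nonzero; $q=\max_j q_j$. ADAL with penalty parameter $\rho>0$ and stepsize $\tau\in(0,1/q)$: given initial $\boldsymbol{\lambda}^0\in\mathbb{R}^m$ and $\mathbf{x}^0$, for $k=0,1,2,\dots$: (1) for every $i$, $\hat{\mathbf{x}}_i^k$ is a solution of the subproblem $\min_{\mathbf{x}_i\in\mathcal{X}_i}\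 f_i(\mathbf{x}_i)+\langle\boldsymbol{\lambda}^k,\mathbf{A}_i\mathbf{x}_i\rangle+\frac\rho2\big\|\mathbf{A}_i\mathbf{x}_i+\sum_{j\ne i}\mathbf{A}_j\mathbf{x}_j^k-\mathbf{b}\big\|^2$; (2) $\mathbf{x}_i^{k+1}=\mathbf{x}_i^k+\tau(\hat{\mathbf{x}}_i^k-\mathbf{x}_i^k)$ for every $i$; (3) $\boldsymbol{\lambda}^{k+1}=\boldsymbol{\lambda}^k+\rho\tau\big(\sum_{i=1}^N\mathbf{A}_i\mathbf{x}_i^{k+1}-\mathbf{b}\big)$. (The algorithm may stop in step 3 if $\mathbf{A}\mathbf{x}^{k+1}=\mathbf{b}$ and $\mathbf{A}_i\hat{\mathbf{x}}_i^k=\mathbf{A}_i\mathbf{x}_i^k$ for all $i$; apart from this stopping test the statement concerns the sequences defined by (1)--(3).) Auxiliary dual variable: $\bar{\boldsymbol{\lambda}}^k=\boldsymbol{\lambda}^k+\rho(1-\tau)\mathbf{r}(\mathbf{x}^k)$. Assumptions: (A1) the functions $f_i$ are convex (not necessarily differentiable) and the sets $\mathcal{X}_i$ are convex, closed and bounded. (A2) $L$ has a saddle point $(\mathbf{x}^*,\boldsymbol{\lambda}^* )\in\mathbb{R}^n\times\mathbb{R}^m$, i.e. $L(\mathbf{x}^*,\boldsymbol{\lambda})\le L(\mathbf{x}^*,\boldsymbol{\lambda}^* )\le L(\mathbf{x},\boldsymbol{\lambda}^* )$ for all $\mathbf{x}\in\mathcal{X}$, $\boldsymbol{\lambda}\in\mathbb{R}^m$;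 in particular $\mathbf{x}^*$ is an optimal solution of the problem. (A3) All subproblems in step (1) are exactly solvable at every iteration. *)

(* Defs.v *)
From HB Require Import structures.
From mathcomp Require Import all_boot all_order all_algebra.
From mathcomp Require Import all_classical all_reals all_analysis.
Import Order.TTheory GRing.Theory Num.Theory.
Import numFieldNormedType.Exports.

Set Implicit Arguments.
Unset Strict Implicit.
Unset Printing Implicit Defensive.

Local Open Scope classical_set_scope.
Local Open Scope ring_scope.

(* The library norm `|_| on matrices is the max-norm; the Euclidean norm is
   introduced here. *)
Definition dotv (R : realType) (d : nat) (u v : 'cV[R]_d) : R :=
  \sum_(j < d) u j 0 * v j 0.

Definition enorm (R : realType) (d : nat) (u : 'cV[R]_d) : R :=
  Num.sqrt (dotv u u).

(* A point x = (x_1, ..., x_N) of R^n, n = n_1 + ... + n_N, given by its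
   blocks. *)
Definition blockvec (R : realType) (N : nat) (n : 'I_N -> nat) : Type :=
  forall i : 'I_N, 'cV[R]_(n i).

Definition objective (R : realType) (N : nat) (n : 'I_N -> nat)
    (f : forall i, 'cV[R]_(n i) -> R) (x : blockvec R n) : R :=
  \sum_(i < N) f i (x i).

Definition feasible_blocks (R : realType) (N : nat) (n : 'I_N -> nat)
    (X : forall i, set 'cV[R]_(n i)) : set (blockvec R n) :=
  [set x | forall i, X i (x i)].

Definition residual (R : realType) (N m : nat) (n : 'I_N -> nat)
    (A : forall i, 'M[R]_(m, n i)) (b : 'cV[R]_m) (x : blockvec R n) :
    'cV[R]_m :=
  \sum_(i < N) A i *m x i - b.

Definition lagrangian (R : realType) (N m : nat) (n : 'I_N -> nat)
    (f : forall i, 'cV[R]_(n i) -> R)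
    (A : forall i, 'M[R]_(m, n i)) (b : 'cV[R]_m)
    (x : blockvec R n) (lam : 'cV[R]_m) : R :=
  objective f x + dotv lam (residual A b x).

(* Saddle points are taken over X * R^m, so the primal part lies in X: this is
   what makes it an optimal solution of the constrained problem. *)
Definition saddle_point (R : realType) (N m : nat) (n : 'I_N -> nat)
    (f : forall i, 'cV[R]_(n i) -> R) (X : forall i, set 'cV[R]_(n i))
    (A : forall i, 'M[R]_(m, n i)) (b : 'cV[R]_m)
    (xs : blockvec R n) (lams : 'cV[R]_m) : Prop :=
  feasible_blocks X xs /\
  forall (x : blockvec R n) (lam : 'cV[R]_m), feasible_blocks X x ->
    lagrangian f A b xs lam <= lagrangian f A b xs lams /\
    lagrangian f A b xs lams <= lagrangian f A b x lams.

Definition row_degree (R : realType) (N m : nat) (n : 'I_N -> nat)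
    (A : forall i, 'M[R]_(m, n i)) (j : 'I_m) : nat :=
  #|[set i : 'I_N | row j (A i) != 0]%SET|.

Definition degree (R : realType) (N m : nat) (n : 'I_N -> nat)
    (A : forall i, 'M[R]_(m, n i)) : nat :=
  (\max_(j < m) row_degree A j)%N.

(* tau \in (0, 1/q), where 1/q is +oo when all the A i vanish (q = 0). *)
Definition admissible_step (R : realType) (q : nat) (tau : R) : Prop :=
  0 < tau /\ ((0 < q)%N -> tau < q%:R^-1).

Definition minimizer_on (R : realType) (T : Type) (D : set T) (g : T -> R)
    (y : T) : Prop :=
  D y /\ forall z, D z -> g y <= g z.

Definition local_aug_lagrangian (R : realType) (N m : nat) (n : 'I_N -> nat)
    (f : forall i, 'cV[R]_(n i) -> R)
    (A : forall i, 'M[R]_(m, n i)) (b : 'cV[R]_m) (rho : R)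
    (x : blockvec R n) (lam : 'cV[R]_m) (i : 'I_N) (y : 'cV[R]_(n i)) : R :=
  f i y + dotv lam (A i *m y)
  + rho / 2 *
    enorm (A i *m y + \sum_(j < N | j != i) A j *m x j - b) ^+ 2.

(* The relation "(x, xhat, lam) is a run of ADAL"; x 0 and lam 0 are free.
   That xhat k i exists, i.e. that every subproblem is exactly solvable, is
   part of the first clause. *)
Definition ADAL (R : realType) (N m : nat) (n : 'I_N -> nat)
    (f : forall i, 'cV[R]_(n i) -> R) (X : forall i, set 'cV[R]_(n i))
    (A : forall i, 'M[R]_(m, n i)) (b : 'cV[R]_m) (rho tau : R)
    (x xhat : nat -> blockvec R n) (lam : nat -> 'cV[R]_m) : Prop :=
  forall k : nat,
  [/\ forall i, minimizer_on (X i)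
        (@local_aug_lagrangian R N m n f A b rho (x k) (lam k) i) (xhat k i),
      forall i, x k.+1 i = x k i + tau *: (xhat k i - x k i) &
      lam k.+1 = lam k + (rho * tau) *: residual A b (x k.+1)].

Definition aux_dual (R : realType) (N m : nat) (n : 'I_N -> nat)
    (A : forall i, 'M[R]_(m, n i)) (b : 'cV[R]_m) (rho tau : R)
    (x : blockvec R n) (lam : 'cV[R]_m) : 'cV[R]_m :=
  lam + (rho * (1 - tau)) *: residual A b x.

Definition primal_dist (R : realType) (N m : nat) (n : 'I_N -> nat)
    (A : forall i, 'M[R]_(m, n i)) (rho : R) (x xs : blockvec R n) : R :=
  \sum_(i < N) rho * enorm (A i *m (x i - xs i)) ^+ 2.

(* phi(lam), with lbar the auxiliary dual variable of the current iterate. *)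
Definition merit (R : realType) (N m : nat) (n : 'I_N -> nat)
    (A : forall i, 'M[R]_(m, n i)) (rho : R) (x xs : blockvec R n)
    (lbar lam : 'cV[R]_m) : R :=
  primal_dist A rho x xs + rho^-1 * enorm (lbar - lam) ^+ 2.

Definition ergodic_avg (R : realType) (N : nat) (n : 'I_N -> nat)
    (xhat : nat -> blockvec R n) (k : nat) : blockvec R n :=
  fun i => k%:R^-1 *: \sum_(p < k) xhat p i.

(* Main.v *)
Require Import Defs.
From HB Require Import structures.
From mathcomp Require Import all_boot all_order all_algebra.
From mathcomp Require Import all_classical all_reals all_analysis.
From mathcomp Require Import ring lra.
Import Order.TTheory GRing.Theory Num.Theory.
Import numFieldNormedType.Exports.

(** Writing r for the residual and lbar for the auxiliary dual variable, the
    proof is a Lyapunov argument with the merit function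
      phi_k(l) = sum_i rho |A_i (x_i^k - x_i^* )|^2 + |lbar^k - l|^2 / rho,
    where the dual point l is left free until the very end.

    Each subproblem is the minimization of a convex function plus a smooth one,
    so its solution satisfies a variational inequality
    ([minimizer_variational_inequality]).  Taking the blocks of x^* as test
    points and summing gives an upper bound on F(xhat^k) - F(x^* )
    ([ADAL_objective_gap]).  The blocks are updated simultaneously, so this
    bound involves r(x^k) rather than r(xhat^k); the discrepancy is
    D = sum_i A_i (xhat_i^k - x_i^k).  A row of the constraints couples at most
    q blocks, whence |D|^2 <= q sum_i |A_i (xhat_i^k - x_i^k)|^2, and
    the condition tau < 1/q lets the proximal terms absorb it
    ([admissible_step_bound]).  The variable lbar is designed so that
    lbar^(k+1) = lbar^k + rho tau r(xhat^k) ([aux_dual_step]); the squares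
    therefore expand without further error terms and, for every l,
      2 tau (F(xhat^k) - F(x^* ) + <l, r(xhat^k)>) <= phi_k(l) - phi_(k+1)(l)
    ([ADAL_merit_decrease]).  Telescoping, discarding the final merit and
    applying Jensen's inequality to F gives, for the ergodic average xt,
      F(xt) - F(x^* ) + <l, r(xt)> <= phi_0(l) / (2 k tau)
    ([ADAL_ergodic_gap]).

    The theorem follows by choosing l.  By the saddle point property,
    0 <= F(xt) - F(x^* ) + <lam^*, r(xt)>.  Hence l = 0 bounds F(xt) - F(x^* )
    from above, l = 2 lam^* bounds it from below, and l = lam^* + u, with u the
    unit vector along r(xt), isolates the norm of r(xt). *)

Set Implicit Arguments.
Unset Strict Implicit.
Unset Printing Implicit Defensive.

Local Open Scope classical_set_scope.
Local Open Scope ring_scope.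

(** * The Euclidean inner product *)

Lemma dotvC (R : realType) (d : nat) (u v : 'cV[R]_d) : dotv u v = dotv v u.
Proof. by apply: eq_bigr => j _; rewrite mulrC. Qed.

Lemma dotvDl (R : realType) (d : nat) (u v w : 'cV[R]_d) :
  dotv (u + v) w = dotv u w + dotv v w.
Proof. by rewrite /dotv -big_split; apply: eq_bigr => j _; rewrite mxE mulrDl. Qed.

Lemma dotvZl (R : realType) (d : nat) (a : R) (u w : 'cV[R]_d) :
  dotv (a *: u) w = a * dotv u w.
Proof. by rewrite /dotv mulr_sumr; apply: eq_bigr => j _; rewrite mxE mulrA. Qed.

Lemma dotvNl (R : realType) (d : nat) (u w : 'cV[R]_d) :
  dotv (- u) w = - dotv u w.
Proof. by rewrite -scaleN1r dotvZl mulN1r. Qed.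

Lemma dot0v (R : realType) (d : nat) (w : 'cV[R]_d) : dotv 0 w = 0.
Proof. by rewrite -[0](scale0r (0 : 'cV[R]_d)) dotvZl mul0r. Qed.

Lemma dotvDr (R : realType) (d : nat) (u v w : 'cV[R]_d) :
  dotv w (u + v) = dotv w u + dotv w v.
Proof. by rewrite dotvC dotvDl !(dotvC w). Qed.

Lemma dotvZr (R : realType) (d : nat) (a : R) (u w : 'cV[R]_d) :
  dotv w (a *: u) = a * dotv w u.
Proof. by rewrite dotvC dotvZl dotvC. Qed.

Lemma dotvNr (R : realType) (d : nat) (u w : 'cV[R]_d) :
  dotv w (- u) = - dotv w u.
Proof. by rewrite dotvC dotvNl dotvC. Qed.

Lemma dotv_sumr (R : realType) (d : nat) (I : Type) (s : seq I) (P : pred I)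
    (w : 'cV[R]_d) (u : I -> 'cV[R]_d) :
  dotv w (\sum_(i <- s | P i) u i) = \sum_(i <- s | P i) dotv w (u i).
Proof.
apply: (big_morph (dotv w)) => [v v'|]; first exact: dotvDr.
by rewrite dotvC dot0v.
Qed.

Definition dotvE := (dotvDl, dotvDr, dotvNl, dotvNr, dotvZl, dotvZr).

Lemma dotv_ge0 (R : realType) (d : nat) (u : 'cV[R]_d) : 0 <= dotv u u.
Proof. by apply: sumr_ge0 => j _; rewrite -expr2 sqr_ge0. Qed.

Lemma dotv_eq0 (R : realType) (d : nat) (u : 'cV[R]_d) :
  dotv u u = 0 -> u = 0.
Proof.
move/eqP; rewrite psumr_eq0 => [/allP u0|j _]; last by rewrite -expr2 sqr_ge0.
apply/colP => j; have := u0 j (mem_index_enum j).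
by rewrite mulf_eq0 orbb mxE => /eqP.
Qed.

Lemma enorm_sqr (R : realType) (d : nat) (u : 'cV[R]_d) :
  enorm u ^+ 2 = dotv u u.
Proof. by rewrite sqr_sqrtr // dotv_ge0. Qed.

(** The dual description of the norm, used to turn a bound on all <l, r> into
    a bound on |r|.  The bound on u is an inequality because r may be 0, and
    then u = 0 is taken. *)
Lemma enorm_attained (R : realType) (d : nat) (r : 'cV[R]_d) :
  exists u, dotv u r = enorm r /\ dotv u u <= 1.
Proof.
have rr : dotv r r = enorm r ^+ 2 by rewrite enorm_sqr.
exists ((enorm r)^-1 *: r); rewrite !(dotvZl, dotvZr) rr.
have [->|r0] := eqVneq (enorm r) 0; first by rewrite expr0n /= !mulr0.
by split; [field | rewrite expr2 mulKf // mulVf].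
Qed.

(** * Convexity and finite averages *)

Lemma convex_function_segment (R : realType) (d : nat) (g : 'cV[R]_d -> R)
    (t : R) (u v : 'cV[R]_d) :
  @convex_function R 'cV[R]_d setT g -> 0 <= t -> t <= 1 ->
  g (t *: u + (1 - t) *: v) <= t * g u + (1 - t) * g v.
Proof.
move=> cg t0 t1; have := cg (Itv01 t0 t1) u v.
by rewrite !inE; apply.
Qed.

Lemma convex_set_segment (R : realType) (d : nat) (D : set 'cV[R]_d)
    (t : R) (u v : 'cV[R]_d) :
  @convex_set R 'cV[R]_d D -> 0 <= t -> t <= 1 -> D u -> D v ->
  D (t *: u + (1 - t) *: v).
Proof.
move=> cD t0 t1 Du Dv; have := cD u v (Itv01 t0 t1).
by rewrite !inE; apply.
Qed.

(** Presenting an average of k + 1 points as a point of a segment, whose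
    endpoints are the average of the first k points and the last point, reduces
    Jensen's inequality to two-point convexity by induction. *)
Lemma average_recr (R : realType) (d : nat) (y : nat -> 'cV[R]_d) (k : nat) :
  (0 < k)%N ->
  let t := k%:R / k.+1%:R in
  k.+1%:R^-1 *: \sum_(p < k.+1) y p
  = t *: (k%:R^-1 *: \sum_(p < k) y p) + (1 - t) *: y k.
Proof.
move=> k0 /=; have k1 : k%:R != 0 :> R by rewrite pnatr_eq0 -lt0n.
have k2 : k.+1%:R != 0 :> R by rewrite pnatr_eq0.
rewrite big_ord_recr /= scalerDr scalerA; congr (_ *: _ + _ *: _).
  by rewrite mulrAC divff ?mul1r.
by apply: (mulIf k2); rewrite mulrBl mul1r mulfVK // mulVf // -natrB // subSnn.
Qed.

Lemma average_weight (R : realType) (k : nat) :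
  0 <= k%:R / k.+1%:R :> R /\ k%:R / k.+1%:R <= 1 :> R.
Proof.
by split; rewrite ?divr_ge0 // ler_pdivrMr ?ltr0n // mul1r ler_nat.
Qed.

Lemma convex_set_average (R : realType) (d : nat) (D : set 'cV[R]_d)
    (y : nat -> 'cV[R]_d) (k : nat) :
  @convex_set R 'cV[R]_d D -> (forall p, D (y p)) -> (0 < k)%N ->
  D (k%:R^-1 *: \sum_(p < k) y p).
Proof.
move=> cD Dy; elim: k => [//|[|k] IH] _.
  by rewrite big_ord_recl big_ord0 addr0 invr1 scale1r.
rewrite average_recr //; have [t0 t1] := average_weight R k.+1.
by apply: convex_set_segment => //; apply: IH.
Qed.

Lemma convex_function_average (R : realType) (d : nat) (g : 'cV[R]_d -> R)
    (y : nat -> 'cV[R]_d) (k : nat) :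
  @convex_function R 'cV[R]_d setT g -> (0 < k)%N ->
  g (k%:R^-1 *: \sum_(p < k) y p) <= k%:R^-1 * \sum_(p < k) g (y p).
Proof.
move=> cg; elim: k => [//|[|k] IH] _.
  by rewrite !big_ord_recl !big_ord0 !addr0 invr1 scale1r mul1r.
rewrite average_recr //; have [t0 t1] := average_weight R k.+1.
apply: le_trans (convex_function_segment _ _ cg t0 t1) _.
have -> : k.+2%:R^-1 * \sum_(p < k.+2) g (y p) =
    k.+1%:R / k.+2%:R * (k.+1%:R^-1 * \sum_(p < k.+1) g (y p))
    + (1 - k.+1%:R / k.+2%:R) * g (y k.+1).
  rewrite big_ord_recr /= (natrD R 1 k.+1).
  have : (0 : R) <= k%:R by [].
  rewrite (natrD R 1 k) => k0; field.
  by apply/andP; split; lra.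
by rewrite lerD2r ler_wpM2l // IH.
Qed.

(** * The degree of the coupling constraints *)

(** Cauchy-Schwarz against the indicator of S; expanding the square as a double
    sum, it reduces to u_i u_j <= (u_i^2 + u_j^2) / 2. *)
Lemma sqr_sum_le (R : realType) (I : finType) (S : {set I}) (u : I -> R) :
  (\sum_(i in S) u i) ^+ 2 <= #|S|%:R * \sum_(i in S) u i ^+ 2.
Proof.
have -> : #|S|%:R * \sum_(i in S) u i ^+ 2 =
    \sum_(i in S) \sum_(j in S) (u i ^+ 2 + u j ^+ 2) / 2.
  transitivity (\sum_(i in S) (#|S|%:R * u i ^+ 2 / 2
      + (\sum_(j in S) u j ^+ 2) / 2)).
    rewrite big_split /= -mulr_suml -mulr_sumr sumr_const -[_ *+ #|S|]mulr_natl.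
    by field.
  apply: eq_bigr => i _; rewrite -mulr_suml big_split /= sumr_const mulrDl.
  by rewrite -[u i ^+ 2 *+ _]mulr_natl.
rewrite expr2 mulr_suml; apply: ler_sum => i _; rewrite mulr_sumr.
by apply: ler_sum => j _; have := sqr_ge0 (u i - u j); nra.
Qed.

(** Cauchy-Schwarz is applied in each row separately, over the blocks that
    really occur in that row.  This yields the factor q, where the triangle
    inequality would give the number N of blocks. *)
Lemma sqr_dotv_sum_le_degree (R : realType) (N m : nat) (n : 'I_N -> nat)
    (A : forall i, 'M[R]_(m, n i)) (z : blockvec R n) :
  dotv (\sum_(i < N) A i *m z i) (\sum_(i < N) A i *m z i)
  <= (degree A)%:R * \sum_(i < N) dotv (A i *m z i) (A i *m z i).
Proof.
rewrite /dotv exchange_big mulr_sumr /=; apply: ler_sum => j _.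
set S := [set i : 'I_N | row j (A i) != 0]%SET.
have zero i : i \notin S -> (A i *m z i) j 0 = 0.
  rewrite inE negbK => /eqP Aij0.
  have -> : (A i *m z i) j 0 = row j (A i *m z i) 0 0 by rewrite [RHS]mxE.
  by rewrite row_mul Aij0 mul0mx mxE.
rewrite summxE (bigID (mem S)) /= [X in _ + X]big1 ?addr0; last exact: zero.
rewrite -expr2; apply: le_trans (sqr_sum_le _ _) _.
have -> : \sum_(i < N) (A i *m z i) j 0 * (A i *m z i) j 0 =
    \sum_(i in S) (A i *m z i) j 0 ^+ 2.
  rewrite (bigID (mem S)) /= [X in _ + X]big1 ?addr0; first exact: eq_bigr.
  by move=> i /zero ->; rewrite mul0r.
apply: ler_wpM2r; first by apply: sumr_ge0 => i _; exact: sqr_ge0.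
by rewrite ler_nat (leq_bigmax (F := row_degree A)).
Qed.

Lemma degree0_mx0 (R : realType) (N m : nat) (n : 'I_N -> nat)
    (A : forall i, 'M[R]_(m, n i)) (i : 'I_N) : degree A = 0%N -> A i = 0.
Proof.
move=> q0; apply/row_matrixP => j; rewrite row0; apply/eqP.
apply: contraT => Aij; have : (row_degree A j <= degree A)%N.
  exact: (leq_bigmax (F := row_degree A)).
by rewrite q0 leqn0 cards_eq0 => /eqP /setP /(_ i); rewrite !inE Aij.
Qed.

(** For q > 0 the left side is at most tau q times the sum, with tau q < 1, and
    tau < 1 makes 2 - tau larger than 1.  For q = 0 the step tau may exceed 2,
    but then every A_i vanishes and both sides are 0. *)
Lemma admissible_step_bound (R : realType) (N m : nat) (n : 'I_N -> nat)
    (A : forall i, 'M[R]_(m, n i)) (tau : R) (z : blockvec R n) :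
  admissible_step (degree A) tau ->
  tau * dotv (\sum_(i < N) A i *m z i) (\sum_(i < N) A i *m z i)
  <= (2 - tau) * \sum_(i < N) dotv (A i *m z i) (A i *m z i).
Proof.
move=> [tau0 tauq]; have := sqr_dotv_sum_le_degree A z.
have [q0|q0] := posnP (degree A).
  rewrite [X in _ <= (_ - _) * X]big1 => [|i _].
    by rewrite mulr0 q0 mul0r => ?; rewrite pmulr_rle0.
  by rewrite (degree0_mx0 i q0) mul0mx dot0v.
have := tauq q0; set q := (_)%:R.
have q1 : 1 <= q by rewrite ler1n.
rewrite -[_^-1]mul1r ltr_pdivlMr; last by lra.
set T := \sum_(i < N) dotv _ _; set D := dotv _ _ => tq DT.
have T0 : 0 <= T by apply: sumr_ge0 => i _; exact: dotv_ge0.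
have := ler_wpM2l (ltW tau0) DT.
have : tau * q * T <= T by rewrite ler_piMl // ltW.
have : tau * T <= T by rewrite ler_piMl //; nra.
lra.
Qed.

(** * First-order optimality of the subproblems *)

(** Replaces the limit t -> 0 in the derivation of a first-order condition. *)
Lemma le0_of_small_slope (R : realType) (a c : R) :
  (forall t, 0 < t -> t <= 1 -> a <= t * c) -> 0 <= c -> a <= 0.
Proof.
move=> ac c0; rewrite leNgt; apply/negP => a0.
have s0 : 0 < a + c + 1 by lra.
(* This t is at most 1 and satisfies t * c < a, a contradiction. *)
have := ac (a / (a + c + 1)).
rewrite divr_gt0 // ler_pdivrMr // mulrAC ler_pdivlMr // mul1r => /(_ isT) h.
have {}h : a * (a + c + 1) <= a * c by apply: h; lra.
nra.
Qed.

(** The point y is compared with y + t (z - y): convexity bounds the increment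
    of g by t (g z - g y), while the increment of the smooth part is its
    differential at y up to a term of order t^2, which disappears after
    dividing by t and letting t tend to 0.  Only the smooth part is
    differentiated, so g need not be differentiable. *)
Lemma minimizer_variational_inequality (R : realType) (m d : nat)
    (D : set 'cV[R]_d) (g : 'cV[R]_d -> R) (M : 'M[R]_(m, d))
    (l c : 'cV[R]_m) (rho : R) (y z : 'cV[R]_d) :
  @convex_set R 'cV[R]_d D -> @convex_function R 'cV[R]_d setT g ->
  0 <= rho ->
  minimizer_on D
    (fun v => g v + dotv l (M *m v) + rho / 2 * enorm (M *m v + c) ^+ 2) y ->
  D z ->
  g y + dotv (l + rho *: (M *m y + c)) (M *m y - M *m z) <= g z.
Proof.
move=> cD cg rho0 [Dy ymin] Dz; rewrite -subr_le0.
set w := M *m z - M *m y; set e := M *m y + c.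
apply: (@le0_of_small_slope _ _ (rho / 2 * dotv w w)); last first.
  by rewrite mulr_ge0 ?dotv_ge0 // divr_ge0.
move=> t t0 t1; have t0' := ltW t0.
have := ymin _ (convex_set_segment cD t0' t1 Dz Dy).
have := convex_function_segment z y cg t0' t1.
have -> : M *m (t *: z + (1 - t) *: y) = M *m y + t *: w.
  by rewrite mulmxDr -!scalemxAr scalerBl scale1r scalerBr addrCA.
have -> : M *m y - M *m z = - w by rewrite opprB.
rewrite addrAC -/e !enorm_sqr !dotvE.
rewrite (dotvC (M *m z) (M *m y)) !(dotvC c).
set gt := g (_ + _) => gtle h; rewrite -(ler_pM2l t0).
lra.
Qed.

(** * Residuals *)

Lemma residualB (R : realType) (N m : nat) (n : 'I_N -> nat)
    (A : forall i, 'M[R]_(m, n i)) (b : 'cV[R]_m) (x y : blockvec R n) :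
  residual A b x - residual A b y = \sum_(i < N) A i *m (x i - y i).
Proof.
rewrite /residual opprB addrA subrK -sumrB.
by apply: eq_bigr => i _; rewrite mulmxBr.
Qed.

(** The map l |-> <l, r(x^* )> is bounded above by its value at lam^*, hence
    vanishes; the point l = lam^* + r(x^* ) is enough to see it. *)
Lemma saddle_point_residual (R : realType) (N m : nat) (n : 'I_N -> nat)
    (f : forall i, 'cV[R]_(n i) -> R) (X : forall i, set 'cV[R]_(n i))
    (A : forall i, 'M[R]_(m, n i)) (b : 'cV[R]_m)
    (xs : blockvec R n) (lams : 'cV[R]_m) :
  saddle_point f X A b xs lams -> residual A b xs = 0.
Proof.
move=> [Xxs saddle]; apply: dotv_eq0; apply/eqP.
rewrite eq_le dotv_ge0 andbT.
have [h _] := saddle xs (lams + residual A b xs) Xxs.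
by move: h; rewrite /lagrangian dotvDl; lra.
Qed.

Lemma residual_ergodic_avg (R : realType) (N m : nat) (n : 'I_N -> nat)
    (A : forall i, 'M[R]_(m, n i)) (b : 'cV[R]_m)
    (y : nat -> blockvec R n) (k : nat) : (0 < k)%N ->
  residual A b (ergodic_avg y k) = k%:R^-1 *: \sum_(p < k) residual A b (y p).
Proof.
move=> k0; have k1 : k%:R != 0 :> R by rewrite pnatr_eq0 -lt0n.
rewrite /residual /ergodic_avg sumrB sumr_const card_ord scalerBr.
rewrite -[b *+ k]scaler_nat scalerA mulVf // scale1r exchange_big /= scaler_sumr.
by congr (_ - _); apply: eq_bigr => i _; rewrite -scalemxAr mulmx_sumr.
Qed.

(** * One iteration *)

(** The sum over the blocks of their variational inequalities.  The gradient of
    the i-th augmented term at xhat_i is taken with the other blocks still at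
    x^k: its residual is r(x^k) + A_i (xhat_i - x_i), which is why r(x^k)
    appears here in place of r(xhat^k). *)
Lemma ADAL_objective_gap (R : realType) (N m : nat) (n : 'I_N -> nat)
    (f : forall i, 'cV[R]_(n i) -> R) (X : forall i, set 'cV[R]_(n i))
    (A : forall i, 'M[R]_(m, n i)) (b : 'cV[R]_m) (rho tau : R)
    (x xhat : nat -> blockvec R n) (lam : nat -> 'cV[R]_m)
    (z : blockvec R n) (k : nat) :
  (forall i, @convex_function R 'cV[R]_(n i) setT (f i)) ->
  (forall i, @convex_set R 'cV[R]_(n i) (X i)) ->
  0 <= rho -> ADAL f X A b rho tau x xhat lam ->
  feasible_blocks X z ->
  objective f (xhat k)
  + dotv (lam k + rho *: residual A b (x k))
         (residual A b (xhat k) - residual A b z)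
  + rho * \sum_(i < N) dotv (A i *m (xhat k i - x k i))
                            (A i *m (xhat k i - z i))
  <= objective f z.
Proof.
move=> cf cX rho0 run Xz; have [opt _ _] := run k.
rewrite residualB dotv_sumr mulr_sumr /objective -!big_split /=.
apply: ler_sum => i _.
set c := \sum_(j < N | j != i) A j *m x k j - b.
have opt_i : minimizer_on (X i) (fun v => f i v + dotv (lam k) (A i *m v)
    + rho / 2 * enorm (A i *m v + c) ^+ 2) (xhat k i).
  have [Xhat hmin] := opt i; split=> // v Xv; have := hmin v Xv.
  by rewrite /local_aug_lagrangian -!addrA.
have := minimizer_variational_inequality (cX i) (cf i) rho0 opt_i (Xz i).
have -> : A i *m xhat k i + c
    = residual A b (x k) + A i *m (xhat k i - x k i).
  rewrite /c /residual [in RHS](bigD1 i) //= mulmxBr.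
  by rewrite [RHS]addrC -!addrA addKr.
by rewrite -mulmxBr !dotvE mulrDr !addrA.
Qed.

(** The residual is affine, so it follows the same relaxation as the blocks. *)
Lemma residual_step (R : realType) (N m : nat) (n : 'I_N -> nat)
    (A : forall i, 'M[R]_(m, n i)) (b : 'cV[R]_m) (tau : R)
    (x y x' : blockvec R n) :
  (forall i, x' i = x i + tau *: (y i - x i)) ->
  residual A b x' = residual A b x + tau *: (residual A b y - residual A b x).
Proof.
move=> x'E; apply/eqP; rewrite addrC -subr_eq !residualB scaler_sumr.
by apply/eqP/eq_bigr => i _; rewrite x'E addrC addKr -scalemxAr.
Qed.

(** This identity is the reason for the correction rho (1 - tau) r(x) in the
    auxiliary dual variable: lam moves along r(x^(k+1)), a mixture of r(x^k) and
    r(xhat^k), and the correction cancels the part along r(x^k). *)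
Lemma aux_dual_step (R : realType) (N m : nat) (n : 'I_N -> nat)
    (f : forall i, 'cV[R]_(n i) -> R) (X : forall i, set 'cV[R]_(n i))
    (A : forall i, 'M[R]_(m, n i)) (b : 'cV[R]_m) (rho tau : R)
    (x xhat : nat -> blockvec R n) (lam : nat -> 'cV[R]_m) (k : nat) :
  ADAL f X A b rho tau x xhat lam ->
  aux_dual A b rho tau (x k.+1) (lam k.+1) =
  aux_dual A b rho tau (x k) (lam k) + (rho * tau) *: residual A b (xhat k).
Proof.
move=> run; have [_ xS lamS] := run k.
rewrite /aux_dual lamS (residual_step A b xS).
set r := residual A b (x k); set h := residual A b (xhat k).
apply/matrixP => i j; rewrite !mxE; ring.
Qed.

(** The expansion of |u + tau d|^2 with u = A_i (x_i - z_i) and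
    d = A_i (y_i - x_i).  The cross term is rewritten with y - z in place of
    x - z, the form in which it occurs in the objective gap; this turns the
    coefficient tau^2 of |d|^2 into tau^2 - 2 tau. *)
Lemma primal_dist_step (R : realType) (N m : nat) (n : 'I_N -> nat)
    (A : forall i, 'M[R]_(m, n i)) (rho tau : R) (x y x' z : blockvec R n) :
  (forall i, x' i = x i + tau *: (y i - x i)) ->
  primal_dist A rho x' z = primal_dist A rho x z + rho *
    (2 * tau * (\sum_(i < N) dotv (A i *m (y i - x i)) (A i *m (y i - z i)))
     - (2 - tau) * tau *
       (\sum_(i < N) dotv (A i *m (y i - x i)) (A i *m (y i - x i)))).
Proof.
move=> x'E; rewrite /primal_dist !mulr_sumr -sumrB mulr_sumr -big_split /=.
apply: eq_bigr => i _; rewrite x'E addrAC mulmxDr -scalemxAr !enorm_sqr.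
have -> : A i *m (y i - z i) = A i *m (x i - z i) + A i *m (y i - x i).
  by rewrite -mulmxDr [x i - z i + _]addrC subrKA.
move: (A i *m (x i - z i)) (A i *m (y i - x i)) => u d.
by rewrite !dotvE (dotvC d u); ring.
Qed.

(** Here lam, r and h play the roles of lam^k, r(x^k) and r(xhat^k), and v that
    of lbar^k - l.  Going from <v, h> to <lam + rho r, h>, the vector of the
    objective gap, leaves rho tau^2 times 2 <r, h> - |h|^2 = |r|^2 - |h - r|^2,
    in which |h - r| is controlled by the step size condition. *)
Lemma dual_dist_step (R : realType) (d : nat) (lam r h l : 'cV[R]_d)
    (rho tau : R) : rho != 0 ->
  let v := lam + (rho * (1 - tau)) *: r - l in
  rho^-1 * (dotv v v - dotv (v + (rho * tau) *: h) (v + (rho * tau) *: h))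
  = - (2 * tau * dotv (lam + rho *: r) h) + 2 * tau * dotv l h
    - rho * tau ^+ 2 * (dotv (h - r) (h - r) - dotv r r).
Proof.
move=> rho0 /=; rewrite !dotvE.
rewrite !(dotvC h r, dotvC h l, dotvC h lam, dotvC r l, dotvC r lam).
by rewrite (dotvC lam l); field.
Qed.

(** Multiplied by 2 tau, the objective gap supplies every term of the decrease
    of the merit except rho tau ((2 - tau) sum_i |A_i (xhat_i - x_i)|^2
    - tau |D|^2) and rho tau^2 |r(x^k)|^2, and both are nonnegative. *)
Lemma ADAL_merit_decrease (R : realType) (N m : nat) (n : 'I_N -> nat)
    (f : forall i, 'cV[R]_(n i) -> R) (X : forall i, set 'cV[R]_(n i))
    (A : forall i, 'M[R]_(m, n i)) (b : 'cV[R]_m) (rho tau : R)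
    (x xhat : nat -> blockvec R n) (lam : nat -> 'cV[R]_m)
    (z : blockvec R n) (l : 'cV[R]_m) (k : nat) :
  (forall i, @convex_function R 'cV[R]_(n i) setT (f i)) ->
  (forall i, @convex_set R 'cV[R]_(n i) (X i)) ->
  0 < rho -> admissible_step (degree A) tau ->
  ADAL f X A b rho tau x xhat lam ->
  feasible_blocks X z -> residual A b z = 0 ->
  2 * tau * (objective f (xhat k) - objective f z
             + dotv l (residual A b (xhat k)))
  <= merit A rho (x k) z (aux_dual A b rho tau (x k) (lam k)) l
     - merit A rho (x k.+1) z (aux_dual A b rho tau (x k.+1) (lam k.+1)) l.
Proof.
move=> cf cX rho0 tau_step run Xz rz.
have tau0 : 0 < tau by case: tau_step.
have gap := ADAL_objective_gap k cf cX (ltW rho0) run Xz.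
have bound := admissible_step_bound (fun i => xhat k i - x k i) tau_step.
have [_ xS _] := run k.
rewrite /merit (primal_dist_step A rho z xS) (aux_dual_step k run) !enorm_sqr.
rewrite /aux_dual [_ + (rho * tau) *: _ - l]addrAC.
have := dual_dist_step (lam k) (residual A b (x k)) (residual A b (xhat k)) l
  tau (lt0r_neq0 rho0).
rewrite /= residualB mulrBr; move: bound gap; rewrite rz subr0.
set SD := dotv (\sum_(i < N) _) _.
set Sdd := \sum_(i < N) dotv (_ *m (_ i - _ i)) (_ *m (_ i - _ i)).
set Sde := \sum_(i < N) dotv _ _.
move: (lam k + _ - l) => v.
move: (dotv (residual _ _ _) (residual _ _ _)) (dotv_ge0 (residual A b (x k))).
move=> rr rr0 bound gap dualE.
have rhotau0 : 0 < rho * tau by rewrite mulr_gt0.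
have := ler_wpM2l (ltW tau0) gap.
have := ler_wpM2l (ltW rhotau0) bound.
have := mulr_ge0 (mulr_ge0 (ltW rhotau0) (ltW tau0)) rr0.
lra.
Qed.

(** * The ergodic average *)

Lemma ADAL_ergodic_gap (R : realType) (N m : nat) (n : 'I_N -> nat)
    (f : forall i, 'cV[R]_(n i) -> R) (X : forall i, set 'cV[R]_(n i))
    (A : forall i, 'M[R]_(m, n i)) (b : 'cV[R]_m) (rho tau : R)
    (x xhat : nat -> blockvec R n) (lam : nat -> 'cV[R]_m)
    (z : blockvec R n) (l : 'cV[R]_m) (k : nat) :
  (forall i, @convex_function R 'cV[R]_(n i) setT (f i)) ->
  (forall i, @convex_set R 'cV[R]_(n i) (X i)) ->
  0 < rho -> admissible_step (degree A) tau ->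
  ADAL f X A b rho tau x xhat lam ->
  feasible_blocks X z -> residual A b z = 0 -> (0 < k)%N ->
  objective f (ergodic_avg xhat k) - objective f z
  + dotv l (residual A b (ergodic_avg xhat k))
  <= (2 * k%:R * tau)^-1 *
     merit A rho (x 0%N) z (aux_dual A b rho tau (x 0%N) (lam 0%N)) l.
Proof.
move=> cf cX rho0 tau_step run Xz rz k0.
have tau0 : 0 < tau by case: tau_step.
have kR0 : 0 < k%:R :> R by rewrite ltr0n.
pose phi j := merit A rho (x j) z (aux_dual A b rho tau (x j) (lam j)) l.
pose gap p := objective f (xhat p) - objective f z
              + dotv l (residual A b (xhat p)).
have phi_ge0 j : 0 <= phi j.
  apply: addr_ge0; last by rewrite mulr_ge0 ?sqr_ge0 // invr_ge0 ltW.
  by apply: sumr_ge0 => i _; rewrite mulr_ge0 ?sqr_ge0 // ltW.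
have telescope : 2 * tau * (\sum_(p < k) gap p) <= phi 0%N - phi k.
  elim: {k0 kR0} k => [|k IH]; first by rewrite big_ord0 mulr0 subrr.
  have := ADAL_merit_decrease l k cf cX rho0 tau_step run Xz rz.
  by rewrite big_ord_recr /= -/(gap k) -/(phi k) -/(phi k.+1); lra.
have jensen : objective f (ergodic_avg xhat k)
    <= k%:R^-1 * \sum_(p < k) objective f (xhat p).
  rewrite /objective exchange_big mulr_sumr /=; apply: ler_sum => i _.
  exact: (convex_function_average (fun p => xhat p i) (cf i)).
have gapE : k%:R^-1 * \sum_(p < k) gap p =
    k%:R^-1 * (\sum_(p < k) objective f (xhat p)) - objective f z
    + dotv l (residual A b (ergodic_avg xhat k)).
  rewrite residual_ergodic_avg // dotvZr dotv_sumr /gap big_split sumrB /=.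
  by rewrite sumr_const card_ord -[objective f z *+ k]mulr_natl; field; lra.
apply: (@le_trans _ _ (k%:R^-1 * \sum_(p < k) gap p)).
  by rewrite gapE !lerD2r.
have -> : (2 * k%:R * tau)^-1 = k%:R^-1 * (2 * tau)^-1 by field; lra.
rewrite -mulrA ler_pM2l ?invr_gt0 // mulrC ler_pdivlMr; last by lra.
rewrite mulrC; apply: le_trans telescope _.
by rewrite lerBlDr lerDl.
Qed.

Theorem theorem2 (R : realType) (N m : nat) (n : 'I_N -> nat)
  (f : forall i : 'I_N, 'cV[R]_(n i) -> R)
  (X : forall i : 'I_N, set 'cV[R]_(n i))
  (A : forall i : 'I_N, 'M[R]_(m, n i)) (b : 'cV[R]_m)
  (f_convex : forall i, @convex_function R 'cV[R]_(n i) setT (f i))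
  (X_convex : forall i, @convex_set R 'cV[R]_(n i) (X i))
  (X_closed : forall i, closed (X i))
  (X_bounded : forall i, bounded_set (X i))
  (xs : blockvec R n) (lams : 'cV[R]_m)
  (saddle : saddle_point f X A b xs lams)
  (rho tau : R) (rho_gt0 : 0 < rho)
  (tau_step : admissible_step (degree A) tau)
  (x xhat : nat -> blockvec R n) (lam : nat -> 'cV[R]_m)
  (run : ADAL f X A b rho tau x xhat lam)
  (k : nat) (k_ge1 : (1 <= k)%N) :
  let xt := ergodic_avg xhat k in
  let lbar0 := aux_dual A b rho tau (x 0%N) (lam 0%N) in
  let phi0 := merit A rho (x 0%N) xs lbar0 in
  `|objective f xt - objective f xs|
    <= (2 * k%:R * tau)^-1 * Num.max (phi0 0) (phi0 (2 *: lams)) /\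
  enorm (residual A b xt)
    <= (2 * k%:R * tau)^-1 *
       (primal_dist A rho (x 0%N) xs
        + 2 / rho * (enorm (lbar0 - lams) ^+ 2 + 1)).
Proof.
move=> xt lbar0 phi0.
have rxs := saddle_point_residual saddle.
have [Xxs saddle_ineq] := saddle.
have gap l : objective f xt - objective f xs + dotv l (residual A b xt)
    <= (2 * k%:R * tau)^-1 * phi0 l.
  exact: (ADAL_ergodic_gap l f_convex X_convex rho_gt0 tau_step run Xxs rxs).
have Xxt : feasible_blocks X xt.
  move=> i; apply: (convex_set_average (y := fun p => xhat p i)) => // p.
  by have [opt _ _] := run p; have [] := opt i.
have lower : 0 <= objective f xt - objective f xs
                  + dotv lams (residual A b xt).
  have [_] := saddle_ineq xt lams Xxt.
  by rewrite /lagrangian rxs dotvC dot0v; lra.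
have c0 : 0 < (2 * k%:R * tau)^-1.
  by rewrite invr_gt0 !mulr_gt0 ?ltr0n //; case: tau_step.
move: (2 * k%:R * tau)^-1 c0 gap => c c0 gap.
split.
  (* With l = 2 lams, the gap is twice a nonnegative quantity minus
     F(xt) - F(xs), hence the lower bound on the latter. *)
  have le1 := gap 0; have le2 := gap (2 *: lams).
  move: le1 le2; rewrite dot0v dotvZl.
  have : c * phi0 0 <= c * Num.max (phi0 0) (phi0 (2 *: lams)).
    by rewrite ler_pM2l // le_max lexx.
  have : c * phi0 (2 *: lams) <= c * Num.max (phi0 0) (phi0 (2 *: lams)).
    by rewrite ler_pM2l // le_max lexx orbT.
  by rewrite ler_norml; lra.
set r := residual A b xt in gap lower *.
have [u [ur u1]] := enorm_attained r.
have := gap (lams + u); rewrite dotvDl ur.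
have : c * phi0 (lams + u) <= c * (primal_dist A rho (x 0%N) xs
    + 2 / rho * (enorm (lbar0 - lams) ^+ 2 + 1)).
  rewrite ler_pM2l // lerD2l [2 / rho]mulrC -mulrA ler_pM2l ?invr_gt0 //.
  rewrite opprD addrA !enorm_sqr; move: (lbar0 - lams) => v.
  (* |v - u|^2 <= 2 |v|^2 + 2 |u|^2 is |v + u|^2 >= 0 rearranged. *)
  have := dotv_ge0 (v + u); rewrite !dotvE (dotvC u v); lra.
lra.
Qed.
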